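(* Let $p$ be a prime and let $a,b,c\in\mathbb{C}_p$ satisfy $b\neq 0$, $c\neq ab$ and $(c-1)^2+4ab=0$. Let $f(x)=\frac{x+a}{bx+c}$ for $x\in\mathbb{C}_p\setminus\{\hat x\}$ with $\hat x=-\frac{c}{b}$, let $x_0=\frac{1-c}{2b}$ (the unique fixed point of $f$), and let $\alpha=\left|\frac{c+1}{2b}\right|_p$. Then: 1. $SI(x_0)=U_\alpha(x_0)$. 2. If $r>\alpha$ and $x\in S_r(x_0)$, then $f(x)\in S_\alpha(x_0)$. 3. Let $x\in S_\alpha(x_0)\setminus\mathcal{P}_p$, and put $\alpha^*(x)=|f(x)-x_0|_p$. 3.1) If $\alpha^*(x)=\alpha$, then $f(x)\in S_\alpha(x_0)$. 3.2) If $\alpha^*(x)>\alpha$, then $f^2(x)\in S_\alpha(x_0)$.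
   Context: $\mathbb{C}_p$ is the field of complex $p$-adic numbers (the completion of an algebraic closure of $\mathbb{Q}_p$) with norm $|\cdot|_p$ extending the $p$-adic norm. For $y\in\mathbb{C}_p$ and $r>0$: $U_r(y)=\{x\in\mathbb{C}_p:|x-y|_p<r\}$ and $S_r(y)=\{x\in\mathbb{C}_p:|x-y|_p=r\}$. $f^n$ denotes the $n$-fold iterate of $f$ (with $f^0(x)=x$), and $\mathcal{P}_p=\{x\in\mathbb{C}_p:\ \exists n\in\mathbb{N}\cup\{0\},\ f^n(x)=\hat x\}$. For a fixed point $x_0$ of $f$, the ball $U_r(x_0)$ is called a Siegel disk if each sphere $S_\rho(x_0)$ with $\rho<r$ is an invariant sphere of $f$, i.e. for every $x\in S_\rho(x_0)$ the iterate $f^n(x)$ is defined and lies in $S_\rho(x_0)$ for all $n=0,1,2,\dots$. The union of all Siegel disks with center $x_0$ is the maximum Siegel disk, denoted $SI(x_0)$. *)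

(* Defs.v *)
From HB Require Import structures.
From mathcomp Require Import all_boot all_order all_algebra.
From mathcomp Require Import classical_sets reals.

Set Implicit Arguments.
Unset Strict Implicit.
Unset Printing Implicit Defensive.

Import Order.TTheory GRing.Theory Num.Theory.
Local Open Scope classical_set_scope.
Local Open Scope ring_scope.

Section ValuedFields.
Variable R : realType.

(* |q|_p = p ^ (- v_p(q)). *)
Definition padic_norm (p : nat) (q : rat) : R :=
  if q == 0 then 0
  else p%:R ^ ((logn p `|denq q|%N)%:Z - (logn p `|numq q|%N)%:Z).

Definition nonarch_norm (K : fieldType) (nu : K -> R) : Prop :=
  [/\ forall x, 0 <= nu x,
      forall x, nu x = 0 <-> x = 0,
      forall x y, nu (x * y) = nu x * nu y
    & forall x y, nu (x + y) <= Num.max (nu x) (nu y)].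

Definition complete_norm (K : fieldType) (nu : K -> R) : Prop :=
  forall u : nat -> K,
    (forall e : R, 0 < e ->
       exists N, forall m n, (N <= m)%N -> (N <= n)%N -> nu (u m - u n) < e) ->
    exists l : K, forall e : R, 0 < e ->
       exists N, forall n, (N <= n)%N -> nu (u n - l) < e.

Definition is_completion (K L : fieldType) (nuK : K -> R) (nuL : L -> R)
    (i : {rmorphism K -> L}) : Prop :=
  [/\ nonarch_norm nuL,
      forall x, nuL (i x) = nuK x,
      complete_norm nuL
    & forall (y : L) (e : R), 0 < e -> exists x : K, nuL (y - i x) < e].

Definition is_normed_alg_closure (K : fieldType) (L : closedFieldType)
    (nuK : K -> R) (nuL : L -> R) (i : {rmorphism K -> L}) : Prop :=
  [/\ nonarch_norm nuL,
      forall x, nuL (i x) = nuK x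
    & forall y : L, algebraicOver i y].

(* The tower rat -> Q_p -> (an algebraic closure of Q_p) -> C_p determines
   (C, nu) up to isometric isomorphism. *)
Definition is_Cp (p : nat) (C : fieldType) (nu : C -> R) : Prop :=
  exists (Qp : fieldType) (nuQp : Qp -> R) (i : {rmorphism rat -> Qp})
         (Qpbar : closedFieldType) (nuQpbar : Qpbar -> R)
         (j : {rmorphism Qp -> Qpbar}) (k : {rmorphism Qpbar -> C}),
    [/\ is_completion (padic_norm p) nuQp i,
        is_normed_alg_closure nuQp nuQpbar j
      & is_completion nuQpbar nu k].

End ValuedFields.

Section Dynamics.
Variables (R : realType) (K : fieldType) (nu : K -> R).

Definition open_ball (r : R) (y : K) : set K := [set x | nu (x - y) < r].
Definition sphere (r : R) (y : K) : set K := [set x | nu (x - y) = r].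

(* A partial self-map g of K is a function K -> option K, with None where g is
   undefined; g^n(x) is defined only if the whole orbit up to time n is. *)
Definition piter (g : K -> option K) (n : nat) (x : K) : option K :=
  iter n (obind g) (Some x).

Definition maps_into (g : K -> option K) (x : K) (A : set K) : Prop :=
  exists2 y, g x = Some y & A y.

Definition pre_orbit (g : K -> option K) (z : K) : set K :=
  [set x | exists n, piter g n x = Some z].

Definition invariant_sphere (g : K -> option K) (rho : R) (y : K) : Prop :=
  forall x, sphere rho y x -> forall n, maps_into (piter g n) x (sphere rho y).

(* The ball of radius r centered at the fixed point y is a Siegel disk. *)
Definition is_siegel_disk (g : K -> option K) (y : K) (r : R) : Prop :=
  [/\ g y = Some y, 0 < r
    & forall rho : R, 0 < rho -> rho < r -> invariant_sphere g rho y].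

Definition max_siegel_disk (g : K -> option K) (y : K) : set K :=
  \bigcup_(r in [set r | is_siegel_disk g y r]) open_ball r y.

Definition fraclin (a b c x : K) : option K :=
  if x == - c / b then None else Some ((x + a) / (b * x + c)).

End Dynamics.

(* Main.v *)
(* In the coordinate t = x - x0 the map f is the parabolic transformation
   t |-> beta * t / (t + beta) with beta = (c + 1) / (2 b) = x0 - xhat. The
   ultrametric inequality gives |t + beta| = max(|t|, |beta|) unless
   |t| = |beta|, so spheres of radius less than alpha = |beta| are preserved
   and those of radius greater than alpha are sent into S_alpha(x0). No Siegel
   disk is larger, because the pole xhat lies on S_alpha(x0). *)

Require Import Defs.
From mathcomp Require Import all_boot all_order all_algebra.
From mathcomp Require Import classical_sets reals.
From mathcomp Require Import ring.

Set Implicit Arguments.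
Unset Strict Implicit.
Unset Printing Implicit Defensive.

Import Order.TTheory GRing.Theory Num.Theory.
Local Open Scope classical_set_scope.
Local Open Scope ring_scope.

Section NonarchNorm.
Variables (R : realType) (K : fieldType) (nu : K -> R).
Hypothesis nu_nonarch : nonarch_norm nu.

Lemma nonarch_norm0 : nu 0 = 0.
Proof. by case: nu_nonarch => _ nu0 _ _; apply/nu0. Qed.

Lemma nonarch_norm_gt0 (x : K) : x != 0 -> 0 < nu x.
Proof.
case: nu_nonarch => nu_ge0 nu0 _ _ x0; rewrite lt_def nu_ge0 andbT.
by apply: contra_neq x0 => /nu0.
Qed.

Lemma nonarch_norm1 : nu 1 = 1.
Proof.
case: nu_nonarch => _ _ nuM _.
have nu1_neq0 : nu 1 != 0 by rewrite gt_eqF // nonarch_norm_gt0 // oner_eq0.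
by apply: (mulfI nu1_neq0); rewrite -nuM !mulr1.
Qed.

Lemma nonarch_normN (x : K) : nu (- x) = nu x.
Proof.
case: nu_nonarch => nu_ge0 _ nuM _.
suff nuN1 : nu (-1) = 1 by rewrite -mulN1r nuM nuN1 mul1r.
(* Since [-1] squares to [1], its norm is a nonnegative real whose square is 1. *)
by apply/eqP; rewrite -sqrp_eq1 // expr2 -nuM mulrNN mulr1 nonarch_norm1.
Qed.

Lemma nonarch_normV (x : K) : nu x^-1 = (nu x)^-1.
Proof.
have [->|x0] := eqVneq x 0; first by rewrite invr0 nonarch_norm0 invr0.
case: nu_nonarch => _ _ nuM _; have nux0 := lt0r_neq0 (nonarch_norm_gt0 x0).
by apply: (mulfI nux0); rewrite -nuM !mulfV // nonarch_norm1.
Qed.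

Lemma nonarch_normDr (x y : K) : nu x < nu y -> nu (x + y) = nu y.
Proof.
case: nu_nonarch => _ _ _ nuD ltxy; apply/eqP; rewrite eq_le.
apply/andP; split.
  by rewrite (le_trans (nuD _ _)) // ge_max (ltW ltxy) /=.
(* Writing [y] as [(x + y) - x] bounds [nu y] by the maximum of [nu (x + y)] and [nu x]; the second
   is too small to be the bound. *)
have := nuD (x + y) (- x); rewrite addrAC subrr add0r nonarch_normN le_max.
by rewrite [X in _ || X]leNgt ltxy orbF.
Qed.

Lemma nonarch_normDl (x y : K) : nu y < nu x -> nu (x + y) = nu x.
Proof. by move=> ltyx; rewrite addrC nonarch_normDr. Qed.

End NonarchNorm.

Lemma is_Cp_nonarch (R : realType) (p : nat) (C : fieldType) (nu : C -> R) :
  is_Cp p nu -> nonarch_norm nu.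
Proof. by move=> [? [? [? [? [? [? [? [_ _ []]]]]]]]]. Qed.

(** The tower composes to a ring morphism from [rat], injective because its source is a field, so
    characteristic 0 is inherited. This permits division by 2 even when [p = 2]. *)
Lemma is_Cp_natr_neq0 (R : realType) (p : nat) (C : fieldType) (nu : C -> R)
    (n : nat) :
  is_Cp p nu -> n.+1%:R != 0 :> C.
Proof.
move=> [Qp [_ [i [Qpbar [_ [j [k _]]]]]]].
by rewrite -(rmorph_nat (k \o j \o i)) fmorph_eq0 pnatr_eq0.
Qed.

Section ParabolicFraclin.
Variables (K : fieldType) (a b c : K).
Hypotheses (two_neq0 : 2%:R != 0 :> K) (b_neq0 : b != 0).
Hypothesis discr0 : (c - 1) ^+ 2 + 4%:R * a * b = 0.

Local Notation x0 := ((1 - c) / (2%:R * b)).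
Local Notation beta := ((c + 1) / (2%:R * b)).

Lemma pole_fraclin : - c / b = x0 - beta.
Proof. by field; rewrite b_neq0 two_neq0. Qed.

(** If [c = -1], the discriminant condition reads [4 + 4ab = 0], whence [ab = -1 = c]. *)
Lemma fraclin_beta_neq0 : c != a * b -> beta != 0.
Proof.
move=> c_neq_ab; rewrite mulf_neq0 ?invr_neq0 ?mulf_neq0 //.
apply: contra_neq c_neq_ab => /eqP; rewrite addr_eq0 => /eqP cN1.
have four_neq0 : 4%:R != 0 :> K by rewrite (natrM _ 2 2) mulf_neq0.
apply: (mulfI four_neq0); apply/eqP; rewrite -subr_eq0 -oppr_eq0 -discr0 cN1.
by apply/eqP; ring.
Qed.

(** As [x0] is fixed, [x + a - x0 (b x + c)] vanishes at [x0], so it equals [(1 - b x0) (x - x0)],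
    where [1 - b x0 = b beta]. The denominator is [b (x - x0 + beta)], and [b] cancels. *)
Lemma fraclinE (x : K) : x - x0 + beta != 0 ->
  exists2 y, fraclin a b c x = Some y &
    y - x0 = beta * (x - x0) / (x - x0 + beta).
Proof.
move=> den_neq0; exists ((x + a) / (b * x + c)).
  rewrite /fraclin pole_fraclin ifN //.
  by apply: contra_neq den_neq0 => ->; ring.
(* Solving the discriminant condition for [a] turns the goal into a rational identity in [b], [c],
   [x] alone, within reach of [field]. *)
have aE : a = - (c - 1) ^+ 2 / (4%:R * b).
  have four_neq0 : 4%:R != 0 :> K by rewrite (natrM _ 2 2) mulf_neq0.
  apply: (mulIf (mulf_neq0 four_neq0 b_neq0)).
  rewrite divfK ?mulf_neq0 //; apply/eqP; rewrite -subr_eq0 -discr0.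
  by apply/eqP; ring.
have denE : x - x0 + beta = (b * x + c) / b by field; rewrite b_neq0 two_neq0.
have bxc_neq0 : b * x + c != 0.
  by apply: contra_neq den_neq0 => e; rewrite denE e mul0r.
rewrite denE aE; field.
by rewrite ?two_neq0 ?b_neq0 ?bxc_neq0 ?(natrM _ 2 2) ?mulf_neq0.
Qed.

Lemma fraclin_fixed : beta != 0 -> fraclin a b c x0 = Some x0.
Proof.
move=> beta_neq0; have [|y -> /eqP] := @fraclinE x0.
  by rewrite subrr add0r.
by rewrite subrr mulr0 mul0r subr_eq0 => /eqP ->.
Qed.

Variables (R : realType) (nu : K -> R).
Hypothesis nu_nonarch : nonarch_norm nu.

(** The denominator [t + beta] has norm [nu beta], which cancels the factor [beta] of the
    numerator. *)
Lemma fraclin_sphere_lt (r : R) (x : K) : r < nu beta -> sphere nu r x0 x ->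
  maps_into (fraclin a b c) x (sphere nu r x0).
Proof.
move=> r_lt nux; case: (nu_nonarch) => nu_ge0 _ nuM _.
have nuden : nu (x - x0 + beta) = nu beta by rewrite nonarch_normDr // nux.
have beta_gt0 : 0 < nu beta by rewrite (le_lt_trans _ r_lt) // -nux.
have [|y fx yE] := @fraclinE x.
  by apply: contra_eq_neq nuden => ->; rewrite nonarch_norm0 // lt_eqF.
exists y => //; rewrite /sphere /= yE nuM (nuM beta).
by rewrite nonarch_normV // nuden nux mulrAC mulfV ?mul1r // gt_eqF.
Qed.

(** Here the denominator has the norm of [t], so only the factor [beta] survives. *)
Lemma fraclin_sphere_gt (r : R) (x : K) : nu beta < r -> sphere nu r x0 x ->
  maps_into (fraclin a b c) x (sphere nu (nu beta) x0).
Proof.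
move=> r_gt nux; case: (nu_nonarch) => nu_ge0 _ nuM _.
have nuden : nu (x - x0 + beta) = r by rewrite nonarch_normDl // nux.
have r_gt0 : 0 < r by rewrite (le_lt_trans _ r_gt).
have [|y fx yE] := @fraclinE x.
  by apply: contra_eq_neq nuden => ->; rewrite nonarch_norm0 // lt_eqF.
exists y => //; rewrite /sphere /= yE nuM (nuM beta).
by rewrite nonarch_normV // nuden nux mulfK // gt_eqF.
Qed.

Lemma fraclin_sphere_invariant (r : R) : r < nu beta ->
  invariant_sphere nu (fraclin a b c) r x0.
Proof.
move=> r_lt x nux; elim=> [|n [y fnx nuy]]; first by exists x.
have [z fy nuz] := fraclin_sphere_lt r_lt nuy.
by exists z => //; move: fnx; rewrite /piter /= => ->.
Qed.

Lemma fraclin_siegel_le (r : R) : beta != 0 ->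
  is_siegel_disk nu (fraclin a b c) x0 r -> r <= nu beta.
Proof.
move=> beta_neq0 [_ _ inv]; rewrite leNgt; apply/negP => r_gt.
have nu_pole : sphere nu (nu beta) x0 (- c / b).
  by rewrite /sphere /= pole_fraclin addrAC subrr add0r nonarch_normN.
(* Invariance of the sphere of radius [nu beta] would make already the first iterate defined at the
   pole. *)
have [y] := inv _ (nonarch_norm_gt0 nu_nonarch beta_neq0) r_gt _ nu_pole 1%N.
by rewrite /piter /= /fraclin eqxx.
Qed.

Lemma fraclin_max_siegel_disk : beta != 0 ->
  max_siegel_disk nu (fraclin a b c) x0 = open_ball nu (nu beta) x0.
Proof.
move=> beta_neq0; apply/seteqP; split=> x.
  move=> [r /(fraclin_siegel_le beta_neq0) r_le x_r].
  exact: lt_le_trans x_r r_le.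
(* The radius [nu beta] is itself admissible, since a Siegel disk constrains only spheres of
   strictly smaller radius. *)
move=> x_beta; exists (nu beta) => //; split.
- exact: fraclin_fixed.
- exact: nonarch_norm_gt0.
- by move=> rho _; apply: fraclin_sphere_invariant.
Qed.

End ParabolicFraclin.

Theorem theorem7 (R : realType) (p : nat) (hp : prime p)
    (Cp : fieldType) (nu : Cp -> R) (hCp : is_Cp p nu)
    (a b c : Cp) (hb : b != 0) (hc : c != a * b)
    (hD : (c - 1) ^+ 2 + 4%:R * a * b = 0) :
  let f := fraclin a b c in
  let xhat := - c / b in
  let x0 := (1 - c) / (2%:R * b) in
  let alpha := nu ((c + 1) / (2%:R * b)) in
  [/\ max_siegel_disk nu f x0 = open_ball nu alpha x0,
      forall (r : R) (x : Cp), alpha < r -> sphere nu r x0 x ->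
        maps_into f x (sphere nu alpha x0)
    & forall x : Cp, (sphere nu alpha x0 `\` pre_orbit f xhat) x ->
        exists2 y, f x = Some y &
          let alpha_star := nu (y - x0) in
          (alpha_star = alpha -> maps_into f x (sphere nu alpha x0)) /\
          (alpha < alpha_star ->
             maps_into (piter f 2) x (sphere nu alpha x0))].
Proof.
move=> f xhat x0 alpha.
have nu_nonarch := is_Cp_nonarch hCp.
have two_neq0 : 2%:R != 0 :> Cp := is_Cp_natr_neq0 1 hCp.
have beta_neq0 := fraclin_beta_neq0 two_neq0 hb hD hc.
have sphere_gt := fraclin_sphere_gt two_neq0 hb hD nu_nonarch.
split; [exact: fraclin_max_siegel_disk | exact: sphere_gt | move=> x [_ xP]].
(* The zeroth iterate puts the pole in its own pre-orbit, so [f] is defined at [x]. *)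
have x_neq : x != xhat.
  by apply/eqP => xE; apply: xP; exists 0; rewrite /piter /= xE.
have fx : f x = Some ((x + a) / (b * x + c)) by rewrite /f /fraclin ifN.
exists ((x + a) / (b * x + c)) => //; split=> [y_alpha|y_gt].
  by exists ((x + a) / (b * x + c)).
have [z fy nuz] := sphere_gt _ _ y_gt erefl.
by exists z => //; rewrite /piter /= fx.
Qed.
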